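(* A poset $P$ on $\{1,2,\ldots,n\}$ is a forest with duplications if and only if the presentation $R_P\cong S/I_P$ is a complete intersection presentation, i.e. if and only if $|\mathcal{J}_{\mathrm{conn}}(P)| = n + |\Pi(P)|$.
   Context: All posets are finite. A weak $P$-partition is a map $f:\{1,\ldots,n\}\to\mathbb{N}$ with $f(i)\ge f(j)$ whenever $i<_P j$; $R_P\subseteq k[x_1,\ldots,x_n]$ ($k$ a field) is the $k$-span of the monomials $x_1^{f(1)}\cdots x_n^{f(n)}$ over weak $P$-partitions $f$; it has Krull dimension $n$. An order ideal is a subset closed downward; a connected order ideal is a nonempty order ideal whose induced Hasse diagram is connected; $\mathcal{J}_{\mathrm{conn}}(P)$ is the set of these. Two connected order ideals intersect trivially if disjoint or nested, nontrivially otherwise; $\Pi(P)$ is the set of unordered pairs of connected order ideals intersecting nontrivially. $S=k[U_J]_{J\in\mathcal{J}_{\mathrm{conn}}(P)}$ maps onto $R_P$ by $U_J\mapsto\prod_{j\in J}x_j$, with kernel $I_P$, which is minimally generated by $|\Pi(P)|$ elements. The presentation $R_P\cong S/I_P$ is called a complete intersection presentation when the Krull dimension $n$ of $R_P$ plus the number $|\Pi(P)|$ of minimal generators of $I_P$ equals the Krull dimension $|\mathcal{J}_{\mathrm{conn}}(P)|$ of $S$. Forests with duplications are the finite posets obtainable from one-element posets by iterating: (1) disjoint union; (2) hanging $P_2$ below an element $a\in P_1$: on $P_1\sqcup P_2$ add relations $p_2<b$ for all $p_2\in P_2$ and all $b\ge_{P_1}a$; (3) duplication of a hanger: $a\in P$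 is a hanger if $P_{<a}\ne\varnothing$ and every path in the Hasse diagram of $P$ from an element of $P_{<a}$ to an element of $P\setminus P_{\le a}$ passes through $a$; duplicating it forms the poset on $P\sqcup\{a'\}$ with the relations of $P$ plus $p<a'$ whenever $p<_Pa$ and $a'<p$ whenever $a<_Pp$. *)

(* Defs.v *)
From mathcomp Require Import all_boot fingroup perm.
Set Implicit Arguments. Unset Strict Implicit. Unset Printing Implicit Defensive.

(* A finite poset on {1,...,n} is encoded on 'I_n by its STRICT order relation
   [lt : rel 'I_n]; [ple lt x y] is the associated non-strict order. *)

Definition ple (T : finType) (lt : rel T) : rel T := fun x y => (x == y) || lt x y.

Definition is_strict_poset (T : finType) (lt : rel T) : Prop :=
  (forall x, ~~ lt x x) /\ (forall x y z, lt x y -> lt y z -> lt x z).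

Definition cover_in (T : finType) (lt : rel T) (A : {pred T}) : rel T :=
  fun x y => [&& x \in A, y \in A, lt x y & ~~ [exists z, (z \in A) && lt x z && lt z y]].

Definition hasse_adj (T : finType) (lt : rel T) (A : {pred T}) : rel T :=
  fun x y => cover_in lt A x y || cover_in lt A y x.

Definition dunion_rel n1 n2 (r1 : rel 'I_n1) (r2 : rel 'I_n2) : rel 'I_(n1 + n2) :=
  fun x y => match split x, split y with
             | inl i, inl j => r1 i j
             | inr i, inr j => r2 i j
             | _, _ => false
             end.

Definition hang_rel n1 n2 (r1 : rel 'I_n1) (r2 : rel 'I_n2) (a : 'I_n1)
  : rel 'I_(n1 + n2) :=
  fun x y => match split x, split y with
             | inl i, inl j => r1 i j
             | inr i, inr j => r2 i j
             | inr _, inl b => ple r1 a b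
             | inl _, inr _ => false
             end.

(* a is a hanger of (T, lt): P_{<a} nonempty and every Hasse-diagram path from
   P_{<a} to P \ P_{<=a} passes through a, i.e. in the Hasse diagram with a
   deleted no element of P_{<a} is connected to an element of P \ P_{<=a}. *)
Definition hanger (T : finType) (lt : rel T) (a : T) : Prop :=
  (exists p, lt p a) /\
  forall p q, lt p a -> ~~ ple lt q a ->
    ~ connect (fun x y => [&& hasse_adj lt predT x y, x != a & y != a]) p q.

Definition dup_rel n (r : rel 'I_n) (a : 'I_n) : rel 'I_n.+1 :=
  fun x y => match unlift ord_max x, unlift ord_max y with
             | Some i, Some j => r i j
             | Some i, None => r i a
             | None, Some j => r a j
             | None, None => false
             end.

Inductive forest_dup : forall n : nat, rel 'I_n -> Prop :=
  | FD_single : forest_dup (fun _ _ : 'I_1 => false)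
  | FD_relabel n (r : rel 'I_n) (s : {perm 'I_n}) :
      forest_dup r -> forest_dup (fun x y => r (s x) (s y))
  | FD_union n1 n2 (r1 : rel 'I_n1) (r2 : rel 'I_n2) :
      forest_dup r1 -> forest_dup r2 -> forest_dup (dunion_rel r1 r2)
  | FD_hang n1 n2 (r1 : rel 'I_n1) (r2 : rel 'I_n2) (a : 'I_n1) :
      forest_dup r1 -> forest_dup r2 -> forest_dup (hang_rel r1 r2 a)
  | FD_dup n (r : rel 'I_n) (a : 'I_n) :
      forest_dup r -> hanger r a -> forest_dup (dup_rel r a).

Definition order_ideal (T : finType) (lt : rel T) (J : {set T}) : bool :=
  [forall x, forall y, (y \in J) && lt x y ==> (x \in J)].

Definition hasse_connected (T : finType) (lt : rel T) (J : {set T}) : bool :=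
  [forall x, forall y, (x \in J) && (y \in J) ==> connect (hasse_adj lt (mem J)) x y].

Definition Jconn (T : finType) (lt : rel T) : {set {set T}} :=
  [set J : {set T} | [&& J != set0, order_ideal lt J & hasse_connected lt J]].

Definition intersect_nontriv (T : finType) (J K : {set T}) : bool :=
  [&& J :&: K != set0, ~~ (J \subset K) & ~~ (K \subset J)].

Definition PiP (T : finType) (lt : rel T) : {set {set {set T}}} :=
  [set [set J; K] | J in Jconn lt, K in [set K in Jconn lt | intersect_nontriv J K]].

(* Main.v *)
Require Import Defs.
From mathcomp Require Import all_boot fingroup perm.
From Stdlib Require Import FunctionalExtensionality.
Set Implicit Arguments. Unset Strict Implicit. Unset Printing Implicit Defensive.

(** Principal ideals are connected, so the claim compares the number of
    non-principal connected ideals with the number of pairs in [PiP].  Sending a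
    pair to its union maps [PiP] onto the non-principal connected ideals, hence
    equality of the two cardinals means that this map is injective.

    Say that [a] and [b] clash if they are incomparable and have a common lower
    bound.  The union map is injective exactly when clashing is a matching and
    clashing elements have the same strict upper bounds.  These two properties
    are preserved by the three constructions.  Conversely, under them, let [a]
    be maximal: if [a] clashes with nothing, its ideal is a component in which
    everything hangs below [a]; if [a] clashes with [b], their two ideals form
    a component, in which the elements below only one of [a], [b] can be
    unhung, after which [b] is a duplicate of [a]. *)

(** Only the common lower bound is confined to [A]. In the decomposition, elements of a subset that
    meet only below elements outside it must not count as joined. *)
Definition clash (T : finType) (lt : rel T) (A : {pred T}) (a b : T) : bool :=
  [&& ~~ ple lt a b, ~~ ple lt b a & [exists z in A, ple lt z a && ple lt z b]].

Definition well_matched (T : finType) (lt : rel T) : Prop :=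
  (forall a b c, clash lt predT a b -> clash lt predT a c -> b = c) /\
  (forall a b c, clash lt predT a b -> lt b c -> lt a c).

Definition down (T : finType) (lt : rel T) (a : T) : {set T} :=
  [set x | ple lt x a].

(** * Order facts, clashes and Hasse paths *)

Section Posets.
Variables (T : finType) (lt : rel T).
Hypothesis lt_poset : is_strict_poset lt.

Lemma lt_irr x : lt x x = false.
Proof. by apply: negbTE; case: lt_poset. Qed.

Lemma lt_tr x y z : lt x y -> lt y z -> lt x z.
Proof. by case: lt_poset => _; apply. Qed.

Lemma ple_refl x : ple lt x x.
Proof. by rewrite /ple eqxx. Qed.

Lemma ltW x y : lt x y -> ple lt x y.
Proof. by rewrite /ple orbC => ->. Qed.

Lemma ple_lt_trans x y z : ple lt x y -> lt y z -> lt x z.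
Proof. by case/orP => [/eqP -> //|]; apply: lt_tr. Qed.

Lemma lt_ple_trans x y z : lt x y -> ple lt y z -> lt x z.
Proof. by move=> xy /orP[/eqP <- //|]; apply: lt_tr. Qed.

Lemma ple_trans x y z : ple lt x y -> ple lt y z -> ple lt x z.
Proof. by move=> xy /orP[/eqP <- //|yz]; apply/ltW/(ple_lt_trans xy). Qed.

Lemma ple_anti x y : ple lt x y -> ple lt y x -> x = y.
Proof.
by case/orP => [/eqP //|xy] /(lt_ple_trans xy); rewrite lt_irr.
Qed.

Lemma clashP (A : {pred T}) a b :
  reflect [/\ ~~ ple lt a b, ~~ ple lt b a &
             exists2 z, z \in A & ple lt z a /\ ple lt z b] (clash lt A a b).
Proof.
apply: (iffP and3P) => -[ab ba].
  by case/exists_inP => z Az /andP[za zb]; split=> //; exists z.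
by case=> z Az [za zb]; split=> //; apply/exists_inP; exists z; rewrite ?za.
Qed.

Lemma clash_sym (A : {pred T}) a b : clash lt A a b -> clash lt A b a.
Proof. by case/clashP => ab ba [z Az [za zb]]; apply/clashP; split=> //; exists z. Qed.

Lemma clash_mono (A : {pred T}) a b : clash lt A a b -> clash lt predT a b.
Proof. by case/clashP => ab ba [z Az [za zb]]; apply/clashP; split=> //; exists z. Qed.

Lemma exists_maximal (A : {set T}) :
  A != set0 -> exists2 a, a \in A & forall x, x \in A -> lt a x = false.
Proof.
case/set0Pn => a0 Aa0.
case: (@arg_maxnP _ a0 (mem A) (fun x => #|down lt x|) Aa0) => a Aa amax.
exists a => // x Ax; apply/negP => ax; have := amax x Ax; apply/negP.
rewrite -ltnNge; apply: proper_card; apply/properP; split.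
  by apply/subsetP => z; rewrite !inE => za; apply: (ple_trans za); apply: ltW.
exists x; rewrite !inE ?ple_refl //; apply/negP.
by move=> /(lt_ple_trans ax); rewrite lt_irr.
Qed.

(** Induction on the size of the open interval, cutting at an intermediate point. The conditions
    concern only elements below [y], so both halves inherit them. The edge relation [e] is left free
    so as to cover the Hasse diagram of an ideal and also the diagram with a hanger deleted. *)
Lemma lt_connect (A : {pred T}) (e : rel T) x y :
  (forall z, ple lt z y -> z \in A) ->
  (forall u v, ple lt v y -> cover_in lt A u v -> e u v) ->
  lt x y -> connect e x y.
Proof.
have [k] := ubnP #|[set z | lt x z && lt z y]|.
elim: k x y => // k IH x y lek Ay ecov xy.
case: (boolP (cover_in lt A x y)) => [cxy|].
  by apply/connect1/ecov => //; apply: ple_refl.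
rewrite /cover_in (Ay x) ?ltW // (Ay y) ?ple_refl // xy /= negbK.
case/existsP => z /andP[/andP[_ xz] zy].
have zint : z \in [set z | lt x z && lt z y] by rewrite inE xz zy.
have small (B : {set T}) : B \subset [set z | lt x z && lt z y] -> z \notin B -> #|B| < k.
  move=> sB zB; rewrite -ltnS; apply: leq_trans lek; rewrite ltnS.
  by apply: proper_card; apply/properP; split=> //; exists z.
apply: (@connect_trans _ _ z); apply: IH => //.
- apply: small; last by rewrite inE lt_irr andbF.
  by apply/subsetP => u; rewrite !inE => /andP[-> /lt_tr]; apply.
- by move=> u uz; apply/Ay/(ple_trans uz)/ltW.
- by move=> u v vz; apply: ecov; apply/(ple_trans vz)/ltW.
- apply: small; last by rewrite inE lt_irr.
  by apply/subsetP => u; rewrite !inE => /andP[/(lt_tr xz) -> ->].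
Qed.

(** * Connected order ideals *)

Lemma idealP (J : {set T}) :
  reflect (forall x y, y \in J -> ple lt x y -> x \in J) (order_ideal lt J).
Proof.
apply: (iffP forallP) => [H x y Jy /orP[/eqP -> //|xy]|H x].
  by have /forallP/(_ y) := H x; rewrite Jy xy.
by apply/forallP => y; apply/implyP => /andP[Jy /ltW]; apply: H.
Qed.

Lemma hasse_connectedP (J : {set T}) :
  reflect {in J &, forall x y, connect (hasse_adj lt (mem J)) x y}
          (hasse_connected lt J).
Proof.
apply: (iffP forallP) => [H x y Jx Jy|H x].
  by have /forallP/(_ y) := H x; rewrite Jx Jy.
by apply/forallP => y; apply/implyP => /andP[]; apply: H.
Qed.

Lemma JconnP (J : {set T}) :
  reflect [/\ exists x, x \in J, order_ideal lt J & hasse_connected lt J]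
          (J \in Jconn lt).
Proof. by rewrite inE; apply: (iffP and3P) => -[/set0Pn]. Qed.

Lemma hasse_connect_sym (A : {pred T}) : connect_sym (hasse_adj lt A).
Proof. by apply: sym_connect_sym => x y; rewrite /hasse_adj orbC. Qed.

Lemma ideal_connect (J : {set T}) x y :
  order_ideal lt J -> y \in J -> ple lt x y -> connect (hasse_adj lt (mem J)) x y.
Proof.
move=> /idealP idJ Jy /orP[/eqP -> //|]; apply: (@lt_connect (mem J)).
  by move=> z; apply: idJ.
by move=> u v _; rewrite /hasse_adj => ->.
Qed.

(** If no comparable pair of [J] crossed the border of [A], then [A] would be closed under Hasse
    edges and no path could leave it. *)
Lemma connected_crossing (J A : {set T}) x y :
  hasse_connected lt J -> x \in J -> y \in J -> x \in A -> y \notin A ->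
  exists u v, [/\ u \in J :&: A, v \in J :\: A & lt u v || lt v u].
Proof.
move=> /hasse_connectedP cJ Jx Jy Ax nAy.
case: (boolP [exists u in J :&: A, exists v in J :\: A, lt u v || lt v u]).
  by case/exists_inP => u Ju /exists_inP[v Jv uv]; exists u, v.
move=> /exists_inPn noc.
suff cl : closed (hasse_adj lt (mem J)) A.
  by have := closed_connect cl (cJ x y Jx Jy); rewrite Ax (negbTE nAy).
have half u v : cover_in lt (mem J) u v -> (u \in A) = (v \in A).
  case/and4P => Ju Jv uv _; apply/idP/idP => Au; apply/negPn/negP => nA.
    have /noc/exists_inPn/(_ v) : u \in J :&: A by rewrite inE Ju.
    by rewrite inE nA Jv uv => /(_ isT).
  have /noc/exists_inPn/(_ u) : v \in J :&: A by rewrite inE Jv.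
  by rewrite inE nA Ju uv orbT => /(_ isT).
by move=> u v /orP[] /half.
Qed.

Lemma down_Jconn a : down lt a \in Jconn lt.
Proof.
have ida : order_ideal lt (down lt a).
  by apply/idealP => x y; rewrite !inE => ya xy; apply: ple_trans ya.
apply/JconnP; split=> //; first by exists a; rewrite inE ple_refl.
have ca x : x \in down lt a -> connect (hasse_adj lt (mem (down lt a))) x a.
  by rewrite inE => xa; apply: ideal_connect; rewrite // inE ple_refl.
apply/hasse_connectedP => x y ax ay; apply: (connect_trans (ca x ax)).
by rewrite hasse_connect_sym ca.
Qed.

Lemma down_inj : injective (down lt).
Proof.
move=> a b ab; apply: ple_anti.
  by move/setP/(_ a): ab; rewrite !inE ple_refl.
by move/setP/(_ b): ab; rewrite !inE ple_refl.
Qed.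

Lemma setU_Jconn (J K : {set T}) z :
  J \in Jconn lt -> K \in Jconn lt -> z \in J -> z \in K -> J :|: K \in Jconn lt.
Proof.
case/JconnP => _ idJ cJ /JconnP[_ idK cK] Jz Kz.
have idU : order_ideal lt (J :|: K).
  apply/idealP => x y; rewrite !inE => /orP[Jy|Ky] xy.
    by rewrite ((idealP _ idJ) x y).
  by rewrite ((idealP _ idK) x y) // orbT.
have to_z (L : {set T}) x : hasse_connected lt L -> L \subset J :|: K ->
    x \in L -> z \in L -> connect (hasse_adj lt (mem (J :|: K))) x z.
  move=> /hasse_connectedP cL /subsetP sL Lx Lz.
  (* Each edge of [L] is used only as a comparability, and an ideal connects comparable elements;
     that covers of [L] stay covers in the union need not be checked. *)
  apply: (connect_sub _ (cL x z Lx Lz)) => u v.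
  case/orP => /and4P[/sL Lu /sL Lv /ltW uv _]; last rewrite hasse_connect_sym.
    exact: ideal_connect.
  exact: ideal_connect.
have toz x : x \in J :|: K -> connect (hasse_adj lt (mem (J :|: K))) x z.
  by case/setUP => Lx; [apply: (to_z J)|apply: (to_z K)];
    rewrite ?subsetUl ?subsetUr.
apply/JconnP; split=> //; first by exists z; rewrite inE Jz.
apply/hasse_connectedP => x y Ux Uy; apply: (connect_trans (toz x Ux)).
by rewrite hasse_connect_sym toz.
Qed.

(** * Counting connected ideals by unions of pairs *)

Lemma ntP (J K : {set T}) :
  reflect [/\ exists2 z, z \in J & z \in K, ~~ (J \subset K) & ~~ (K \subset J)]
          (intersect_nontriv J K).
Proof.
apply: (iffP and3P) => -[h ? ?]; split=> //.
  by case/set0Pn: h => z /setIP[]; exists z.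
by case: h => z Jz Kz; apply/set0Pn; exists z; rewrite inE Jz.
Qed.

Lemma PiPP (S : {set {set T}}) :
  reflect (exists J K, [/\ S = [set J; K], J \in Jconn lt, K \in Jconn lt
                        & intersect_nontriv J K]) (S \in PiP lt).
Proof.
apply: (iffP imset2P) => [[J K cJ]|[J [K [-> cJ cK nt]]]].
  by rewrite inE => /andP[cK nt] ->; exists J, K.
by exists J K => //; rewrite inE cK.
Qed.

Lemma cover2 (J K : {set T}) : cover [set J; K] = J :|: K.
Proof. by rewrite /cover bigcup_setU !big_set1. Qed.

(** The element [a] would lie in one of the two ideals, which would then contain all of [down lt a]
    and so the other ideal. *)
Lemma nontriv_union_not_down (J K : {set T}) a :
  J \in Jconn lt -> K \in Jconn lt -> intersect_nontriv J K -> J :|: K != down lt a.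
Proof.
case/JconnP => _ /idealP idJ _ /JconnP[_ /idealP idK _] /ntP[_ nJK nKJ].
apply/eqP => E; have : a \in J :|: K by rewrite E inE ple_refl.
case/setUP => [Ja|Ka].
  case/negP: nKJ; apply/subsetP => x Kx; apply: (idJ x a Ja).
  by have := subsetP (subsetUr J K) x Kx; rewrite E inE.
case/negP: nJK; apply/subsetP => x Jx; apply: (idK x a Ka).
by have := subsetP (subsetUl J K) x Jx; rewrite E inE.
Qed.

(* Split off the principal ideal of a point just outside a largest proper
   connected subideal. *)
Lemma nonprincipal_split (J : {set T}) :
  J \in Jconn lt -> J \notin [set down lt a | a in T] ->
  exists K m, [/\ K \in Jconn lt, intersect_nontriv K (down lt m)
               & K :|: down lt m = J].
Proof.
move=> cJ npJ; have /JconnP[[x0 Jx0] idJ hJ] := cJ.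
have nd a : J <> down lt a by move=> E; case/negP: npJ; rewrite E imset_f.
have dsub a : a \in J -> down lt a \subset J.
  by move=> Ja; apply/subsetP => x; rewrite inE; apply: (idealP _ idJ).
pose Q (K : {set T}) := (K \in Jconn lt) && (K \proper J).
have Q0 : Q (down lt x0).
  rewrite /Q down_Jconn properEneq dsub // andbT.
  by apply/eqP => E; apply: (nd x0).
case: (@arg_maxnP _ _ Q (fun K => #|K|) Q0) => K /andP[cK KJ] maxK.
have /JconnP[[k Kk] /idealP idK hK] := cK.
have /properP[sKJ [y Jy nKy]] := KJ.
have [u [m []]] := connected_crossing hJ (subsetP sKJ k Kk) Jy Kk nKy.
rewrite !inE => /andP[Ju Ku] /andP[nKm Jm] um.
(* The crossing pair can only go upwards out of [K], since [K] is closed downward. *)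
have {}um : ple lt u m.
  case/orP: um => [/ltW //|mu]; case/negP: nKm; apply: (idK m u Ku).
  exact: ltW.
exists K, m; have um' : u \in down lt m by rewrite inE.
have cU := setU_Jconn cK (down_Jconn m) Ku um'.
have EU : K :|: down lt m = J.
  apply/eqP; have sU : K :|: down lt m \subset J by rewrite subUset sKJ dsub.
  rewrite eqEproper sU /=; apply/negP => pU.
  have /maxK : Q (K :|: down lt m) by rewrite /Q cU.
  apply/negP; rewrite -ltnNge; apply: proper_card; apply/properP.
  by split; [apply: subsetUl|exists m; rewrite // !inE ple_refl orbT].
split=> //; apply/ntP; split; first by exists u.
  by apply/negP => /setUidPr E; apply: (nd m); rewrite -EU.
by apply/negP => /subsetP/(_ m); rewrite inE ple_refl => /(_ isT); apply/negP.
Qed.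

Lemma cover_PiP :
  @cover T @: PiP lt = Jconn lt :\: [set down lt a | a in T].
Proof.
apply/setP => J; rewrite inE; apply/imsetP/andP.
  case=> S /PiPP[K [L [-> cK cL nt]]] ->; rewrite cover2; split.
    apply/negP => /imsetP[a _ E].
    by have /eqP := nontriv_union_not_down a cK cL nt.
  by case/ntP: (nt) => -[z Kz Lz] _ _; apply: (@setU_Jconn K L z).
case=> npJ cJ; have [K [m [cK nt E]]] := nonprincipal_split cJ npJ.
exists [set K; down lt m]; last by rewrite cover2.
by apply/PiPP; exists K, (down lt m); split=> //; apply: down_Jconn.
Qed.

Lemma card_Jconn : #|Jconn lt| = #|T| + #|@cover T @: PiP lt|.
Proof.
rewrite cover_PiP -(cardsID [set down lt a | a in T] (Jconn lt)); congr (_ + _).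
rewrite -(card_imset predT down_inj); apply: eq_card => J; rewrite inE.
apply: andb_idl => /imsetP[a _ ->]; exact: down_Jconn.
Qed.

Lemma card_Jconn_eq_inj :
  #|Jconn lt| = #|T| + #|PiP lt| <-> {in PiP lt &, injective (@cover T)}.
Proof.
rewrite card_Jconn; split=> [/addnI E|inj].
  by apply/imset_injP; rewrite E.
by congr (_ + _); apply: card_in_imset.
Qed.

(** * Injectivity of the union map in terms of clashes *)

(** Each violation produces two different pairs with the same union. Write [A], [B], [C] for the
    principal ideals of [a], [b], [c]. If [b] is below [c] but [a] is not, the pairs are [A], [C]
    and [A :|: B], [C]. If [a] clashes with both [b] and [c], they are [A :|: B], [C] and [A :|: C],
    [B]. *)
Lemma cover_inj_well_matched :
  {in PiP lt &, injective (@cover T)} -> well_matched lt.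
Proof.
move=> inj.
have pair J K : J \in Jconn lt -> K \in Jconn lt -> intersect_nontriv J K ->
  [set J; K] \in PiP lt by move=> ? ? ?; apply/PiPP; exists J, K.
have upper a b c : clash lt predT a b -> lt b c -> lt a c.
  case/clashP => ab ba [z _ [za zb]] bc; apply/negPn/negP => nac.
  have nca : ~~ ple lt c a.
    by apply/negP => ca; case/negP: ba; apply: ltW; apply: lt_ple_trans ca.
  have {}nac : ~~ ple lt a c.
    rewrite /ple negb_or nac andbT; apply/eqP => E.
    by rewrite E ple_refl in nca.
  have bc' := ltW bc; have zc := ple_trans zb bc'.
  have cab : down lt a :|: down lt b \in Jconn lt.
    by apply: (@setU_Jconn _ _ z); rewrite ?down_Jconn // inE.
  have nt1 : intersect_nontriv (down lt a) (down lt c).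
    apply/ntP; split; first by exists z; rewrite inE.
      by apply/subsetPn; exists a; rewrite inE ?ple_refl.
    by apply/subsetPn; exists c; rewrite inE ?ple_refl.
  have nt2 : intersect_nontriv (down lt a :|: down lt b) (down lt c).
    apply/ntP; split; first by exists z; rewrite !inE ?za.
      by apply/subsetPn; exists a; rewrite !inE ?ple_refl.
    apply/subsetPn; exists c; rewrite !inE ?ple_refl // negb_or nca /=.
    by apply/negP => cb; move: (lt_ple_trans bc cb); rewrite lt_irr.
  have E : [set down lt a; down lt c] = [set down lt a :|: down lt b; down lt c].
    apply: inj; try by apply: pair; rewrite ?down_Jconn.
    rewrite !cover2 -setUA; congr (_ :|: _); apply/esym/setUidPr.
    by apply/subsetP => x; rewrite !inE => /ple_trans; apply.
  have : down lt a :|: down lt b \in [set down lt a; down lt c].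
    by rewrite E !inE eqxx.
  rewrite !inE => /orP[] /eqP/setP.
    by move/(_ b); rewrite !inE ple_refl orbT (negbTE ba).
  by move/(_ a); rewrite !inE ple_refl (negbTE nac).
split=> // a b c ab ac; apply/eqP/negPn/negP => nbc.
(* If [b] and [c] were comparable, [upper] would put [a] below one of them, against the clash. *)
have bc : ~~ ple lt b c.
  apply/negP => /orP[/eqP E|/(upper _ _ _ ab)]; first by rewrite E eqxx in nbc.
  by case/clashP: ac => + _ _ /ltW; move/negbTE ->.
have cb : ~~ ple lt c b.
  apply/negP => /orP[/eqP E|/(upper _ _ _ ac)]; first by rewrite E eqxx in nbc.
  by case/clashP: ab => + _ _ /ltW; move/negbTE ->.
case/clashP: ab => ab ba [z _ [za zb]]; case/clashP: ac => ac ca [w _ [wa wc]].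
have cab : down lt a :|: down lt b \in Jconn lt.
  by apply: (@setU_Jconn _ _ z); rewrite ?down_Jconn // inE.
have cac : down lt a :|: down lt c \in Jconn lt.
  by apply: (@setU_Jconn _ _ w); rewrite ?down_Jconn // inE.
have E : [set down lt a :|: down lt b; down lt c]
       = [set down lt a :|: down lt c; down lt b].
  apply: inj; last by rewrite !cover2 -!setUA [down lt b :|: _]setUC.
    apply: pair => //; first exact: down_Jconn.
    apply/ntP; split; first by exists w; rewrite !inE ?wa.
      by apply/subsetPn; exists a; rewrite !inE ?ple_refl.
    by apply/subsetPn; exists c; rewrite !inE ?ple_refl // negb_or ca.
  apply: pair => //; first exact: down_Jconn.
  apply/ntP; split; first by exists z; rewrite !inE ?za.
    by apply/subsetPn; exists a; rewrite !inE ?ple_refl.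
  by apply/subsetPn; exists b; rewrite !inE ?ple_refl // negb_or ba.
have : down lt a :|: down lt b \in [set down lt a :|: down lt c; down lt b].
  by rewrite -E !inE eqxx.
rewrite !inE => /orP[] /eqP/setP.
  by move/(_ b); rewrite !inE ple_refl orbT (negbTE ba) (negbTE bc).
by move/(_ a); rewrite !inE ple_refl (negbTE ab).
Qed.

(** Were [J] larger than the ideal of its maximal element [a], a comparability would leave that
    ideal and end in an element clashing with [a]. Matching leaves room for only one such
    element. *)
Lemma connected_ideal_cases (J : {set T}) a :
  well_matched lt -> J \in Jconn lt -> a \in J ->
  (forall x, x \in J -> lt a x = false) ->
  J = down lt a \/
  exists2 b, b \in J & clash lt predT a b /\ J = down lt a :|: down lt b.
Proof.
move=> [matched upper] /JconnP[_ /idealP idJ hJ] Ja amax.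
have step u v x : x \in J -> v \in J -> ple lt u x -> ~~ ple lt v x ->
    lt u v || lt v u -> lt x v = false -> clash lt predT x v.
  move=> Jx Jv ux nvx uv nxv; apply/clashP; split=> //.
    rewrite /ple nxv orbF; apply/eqP => E; by rewrite E ple_refl in nvx.
  case/orP: uv => [/ltW uv|vu]; first by exists u.
  by case/negP: nvx; apply: ltW; apply: lt_ple_trans ux.
have dsub x : x \in J -> down lt x \subset J.
  by move=> Jx; apply/subsetP => y; rewrite inE; apply: idJ.
case: (boolP [exists b in J, clash lt predT a b]) => [/exists_inP[b Jb ab]|].
  right; exists b => //; split=> //; apply/eqP.
  rewrite eqEsubset subUset !dsub // !andbT; apply/subsetP => y Jy.
  apply/negPn/negP => nUy.
  have Ua : a \in down lt a :|: down lt b by rewrite !inE ple_refl.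
  have [u [v []]] := connected_crossing hJ Ja Jy Ua nUy.
  rewrite !inE => /andP[Ju /orP uU] /andP[/norP[nva nvb] Jv] uv.
  case: uU => [ua|ub].
    have /(matched _ _ _ ab) E := step u v a Ja Jv ua nva uv (amax v Jv).
    by rewrite -E ple_refl in nvb.
  (* Since [b] has the strict upper bounds of [a], it is maximal in [J] too, so the crossing
     argument applies to it as well. *)
  have bv : lt b v = false.
    by apply/negP => /(upper _ _ _ ab); rewrite amax.
  have /(matched _ _ _ (clash_sym ab)) E := step u v b Jb Jv ub nvb uv bv.
  by rewrite -E ple_refl in nva.
move=> /exists_inPn noc; left; apply/eqP.
rewrite eqEsubset dsub // andbT; apply/subsetP => y Jy; apply/negPn/negP => nUy.
have Ua : a \in down lt a by rewrite inE ple_refl.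
have [u [v []]] := connected_crossing hJ Ja Jy Ua nUy.
rewrite !inE => /andP[Ju ua] /andP[nva Jv] uv; have /negP := noc v Jv; apply.
exact: (step u v a Ja Jv ua nva uv (amax v Jv)).
Qed.

(** An ideal holding both [a] and [b] would swallow the other one, so each of [J], [K] holds exactly
    one of them, as a maximal element. A connected ideal that misses the clash partner of its
    maximal element is principal. *)
Lemma nontriv_pair_unique (J K : {set T}) a b :
  well_matched lt -> J \in Jconn lt -> K \in Jconn lt -> intersect_nontriv J K ->
  clash lt predT a b -> J :|: K = down lt a :|: down lt b ->
  [set J; K] = [set down lt a; down lt b].
Proof.
move=> wm; wlog Ja : J K / a \in J.
  move=> H cJ cK nt ab E.
  have : a \in J :|: K by rewrite E !inE ple_refl.
  case/setUP => [Ja|Ka]; first exact: H.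
  rewrite setUC; apply: H => //; last by rewrite setUC.
  by case/ntP: nt => -[z Jz Kz] ? ?; apply/ntP; split=> //; exists z.
move=> cJ cK /ntP[_ nJK nKJ] ab E; have [matched _] := wm.
have /JconnP[_ /idealP idJ _] := cJ; have /JconnP[_ /idealP idK _] := cK.
have inU x : x \in J :|: K -> ple lt x a || ple lt x b by rewrite E !inE.
have full L M : order_ideal lt L -> a \in L -> b \in L ->
    L :|: M = down lt a :|: down lt b -> M \subset L.
  move=> /idealP idL La Lb EL; apply/subsetP => x Mx.
  have : x \in L :|: M by rewrite inE Mx orbT.
  by rewrite EL !inE => /orP[]; apply: idL.
have Jb : b \notin J.
  apply: contra nKJ => Jb; apply: full => //; by case/JconnP: cJ.
have Kb : b \in K.
  have : b \in J :|: K by rewrite E !inE ple_refl orbT.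
  by rewrite inE (negbTE Jb).
have Ka : a \notin K.
  apply: contra nJK => Ka; apply: full => //; first by case/JconnP: cK.
  by rewrite setUC.
have /clashP[nab nba _] := ab.
have top x y z : ~~ ple lt x y -> lt x z -> ple lt z x || ple lt z y -> False.
  move=> nxy xz /orP[zx|zy]; first by move: (lt_ple_trans xz zx); rewrite lt_irr.
  by case/negP: nxy; apply: ltW; apply: lt_ple_trans zy.
have EJ : J = down lt a.
  case: (connected_ideal_cases wm cJ Ja).
  - move=> x Jx; apply/negP => ax; apply: (top a b x nab ax); apply: inU.
    by rewrite inE Jx.
  - by [].
  - by case=> c Jc [/(matched _ _ _ ab) Ec _]; rewrite Ec Jc in Jb.
have EK : K = down lt b.
  case: (connected_ideal_cases wm cK Kb).
  - move=> x Kx; apply/negP => bx; apply: (top b a x nba bx); rewrite orbC.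
    by apply: inU; rewrite inE Kx orbT.
  - by [].
  - by case=> c Kc [/(matched _ _ _ (clash_sym ab)) Ec _]; rewrite Ec Kc in Ka.
by rewrite EJ EK.
Qed.

(** A maximal element [a] of the common union has a clash partner [b], as the union is not
    principal. Both pairs are then the principal ideals of [a] and [b]. *)
Lemma well_matched_cover_inj :
  well_matched lt -> {in PiP lt &, injective (@cover T)}.
Proof.
move=> wm S1 S2 /PiPP[J [K [-> cJ cK nt]]] /PiPP[J' [K' [-> cJ' cK' nt']]].
rewrite !cover2 => E.
have cU : J :|: K \in Jconn lt.
  by case/ntP: (nt) => -[z Jz Kz] _ _; apply: (@setU_Jconn _ _ z).
have /exists_maximal[a Ua amax] : J :|: K != set0.
  by case/JconnP: cU => /set0Pn.
case: (connected_ideal_cases wm cU Ua amax).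
  by move=> Ea; have /eqP := nontriv_union_not_down a cJ cK nt.
case=> b _ [ab EU]; rewrite (nontriv_pair_unique wm cJ cK nt ab EU).
by apply/esym/nontriv_pair_unique => //; rewrite -E.
Qed.

(** * Decomposing a well matched poset *)

(** The order induced on [A], up to an isomorphism with some ['I_n]; this lets the induction run
    over subsets of one fixed poset. *)
Definition forest_dup_on (A : {set T}) : Prop :=
  exists n (r : rel 'I_n) (f : 'I_n -> T),
    [/\ forest_dup r, injective f, f @: setT = A
      & forall i j, r i j = lt (f i) (f j)].

Lemma forest_dup_on1 a : forest_dup_on [set a].
Proof.
exists 1, (fun _ _ => false), (fun=> a); split.
- exact: FD_single.
- by move=> i j _; rewrite !ord1.
- apply/setP => x; rewrite inE; apply/imsetP/eqP => [[i _ -> //]|->].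
  by exists ord0.
- by move=> i j; rewrite lt_irr.
Qed.

Definition sum_fun n1 n2 (f1 : 'I_n1 -> T) (f2 : 'I_n2 -> T) : 'I_(n1 + n2) -> T :=
  fun x => match split x with inl i => f1 i | inr j => f2 j end.

Lemma sum_fun_inj n1 n2 (f1 : 'I_n1 -> T) (f2 : 'I_n2 -> T) (A B : {set T}) :
  injective f1 -> injective f2 -> f1 @: setT = A -> f2 @: setT = B ->
  [disjoint A & B] ->
  injective (sum_fun f1 f2) /\ sum_fun f1 f2 @: setT = A :|: B.
Proof.
move=> inj1 inj2 E1 E2 dAB.
have dis i j : f1 i <> f2 j.
  move=> e; have : f1 i \in A by rewrite -E1 imset_f.
  move/(disjointFr dAB); rewrite e -E2 imset_f //.
split.
  move=> x y; rewrite /sum_fun -{2}(splitK x) -{2}(splitK y).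
  case: (split x) (split y) => i [] j => [/inj1 -> //|/dis //||/inj2 -> //].
  by move/esym/dis.
apply/setP => z; rewrite !inE -E1 -E2; apply/imsetP/orP.
  case=> x _ ->; rewrite /sum_fun; case: (split x) => i.
    by left; apply: imset_f.
  by right; apply: imset_f.
case=> /imsetP[i _ ->].
  by exists (unsplit (inl i)); rewrite // /sum_fun unsplitK.
by exists (unsplit (inr i)); rewrite // /sum_fun unsplitK.
Qed.

Lemma forest_dup_onU (A B : {set T}) :
  forest_dup_on A -> forest_dup_on B -> [disjoint A & B] ->
  {in A & B, forall x y, lt x y = false /\ lt y x = false} ->
  forest_dup_on (A :|: B).
Proof.
move=> [n1 [r1 [f1 [d1 i1 E1 h1]]]] [n2 [r2 [f2 [d2 i2 E2 h2]]]] dAB nc.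
have [inj E] := sum_fun_inj i1 i2 E1 E2 dAB.
exists (n1 + n2), (dunion_rel r1 r2), (sum_fun f1 f2); split=> //.
  exact: FD_union.
have inA i : f1 i \in A by rewrite -E1 imset_f.
have inB i : f2 i \in B by rewrite -E2 imset_f.
move=> x y; rewrite /dunion_rel /sum_fun.
case: (split x) (split y) => i [] j //.
  by case: (nc _ _ (inA i) (inB j)).
by case: (nc _ _ (inA j) (inB i)).
Qed.

Lemma forest_dup_on_hang (A B : {set T}) a :
  forest_dup_on A -> forest_dup_on B -> [disjoint A & B] -> a \in A ->
  {in A & B, forall x y, lt x y = false /\ lt y x = ple lt a x} ->
  forest_dup_on (A :|: B).
Proof.
move=> [n1 [r1 [f1 [d1 i1 E1 h1]]]] [n2 [r2 [f2 [d2 i2 E2 h2]]]] dAB Aa nc.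
have [inj E] := sum_fun_inj i1 i2 E1 E2 dAB.
have /imsetP[ia _ Ea] : a \in f1 @: setT by rewrite E1.
exists (n1 + n2), (hang_rel r1 r2 ia), (sum_fun f1 f2); split=> //.
  exact: FD_hang.
have inA i : f1 i \in A by rewrite -E1 imset_f.
have inB i : f2 i \in B by rewrite -E2 imset_f.
move=> x y; rewrite /hang_rel /sum_fun.
case: (split x) (split y) => i [] j //.
  by case: (nc _ _ (inA i) (inB j)).
case: (nc _ _ (inA j) (inB i)) => _ ->.
by rewrite /ple h1 Ea (inj_eq i1).
Qed.

(** As [a] is the top of [A], nothing lies outside its ideal, so the separation half of being a
    hanger is vacuous; [p] supplies the other half. The last index stands for the copy [b]. *)
Lemma forest_dup_on_dup (A : {set T}) a b p :
  forest_dup_on A -> a \in A -> b \notin A -> p \in A -> lt p a ->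
  {in A, forall x, ple lt x a} ->
  {in A, forall x, lt x b = lt x a /\ lt b x = lt a x} ->
  forest_dup_on (b |: A).
Proof.
move=> [n [r [f [d inj E h]]]] Aa nAb Ap pa top nc.
have /imsetP[ia _ Ea] : a \in f @: setT by rewrite E.
have /imsetP[ip _ Ep] : p \in f @: setT by rewrite E.
have inA i : f i \in A by rewrite -E imset_f.
have nb i : f i <> b by move=> e; rewrite -e inA in nAb.
exists n.+1, (dup_rel r ia), (fun x => if unlift ord_max x is Some i then f i else b).
split.
- apply: FD_dup => //; split; first by exists ip; rewrite h -Ep -Ea.
  move=> p' q _; rewrite /ple h -(inj_eq inj) -Ea.
  by have := top _ (inA q); rewrite /ple => ->.
- move=> x y; case: (unliftP ord_max x) => [i ->|->];
    case: (unliftP ord_max y) => [j ->|->] //.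
  + by move/inj ->.
  + by move/nb.
  + by move/esym/nb.
- apply/setP => z; rewrite !inE -E; apply/imsetP/orP.
    case=> x _ ->; case: unliftP => [i _|_]; last by left.
    by right; apply: imset_f.
  case=> [/eqP ->|/imsetP[i _ ->]]; first by exists ord_max; rewrite ?unlift_none.
  by exists (lift ord_max i); rewrite ?liftK.
- move=> x y; rewrite /dup_rel; case: unliftP => [i _|_]; case: unliftP => [j _|_] //.
  + by case: (nc _ (inA i)) => ->; rewrite h Ea.
  + by case: (nc _ (inA j)) => _ ->; rewrite h Ea.
  + by rewrite lt_irr.
Qed.

(** The elements [C] below [a] but not below [b] form a part hanging below [a]: nothing else of [A]
    lies under [C], and only [a] lies above it. *)
Lemma forest_dup_on_unhang (A : {set T}) a b :
  well_matched lt -> clash lt predT a b -> a \in A -> b \in A ->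
  {in A, forall x, lt a x = false} ->
  {in A, forall x, ple lt x a || ple lt x b} ->
  let C := [set x in A | lt x a && ~~ ple lt x b] in
  C != set0 -> (forall B : {set T}, B \proper A -> B != set0 -> forest_dup_on B) ->
  forest_dup_on A.
Proof.
move=> [matched upper] ab Aa Ab amax cov C C0 IH.
have /clashP[nab nba _] := ab.
have sCA : C \subset A by apply/subsetP => x; rewrite inE => /andP[].
have aC : a \notin C by rewrite inE lt_irr andbF.
have bC : b \notin C by rewrite inE ple_refl !andbF.
have -> : A = (A :\: C) :|: C by rewrite setUC -{1}(setIidPr sCA) setID.
apply: (@forest_dup_on_hang _ _ a).
- apply: IH; last by apply/set0Pn; exists a; rewrite inE aC.
  case/set0Pn: C0 => c Cc; apply/properP; split; first exact: subsetDl.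
  by exists c; [apply: (subsetP sCA)|rewrite inE Cc].
- apply: IH => //; apply/properP; split=> //; by exists a.
- by rewrite -setI_eq0 setIDAC setDIl setDv setI0.
- by rewrite inE aC.
move=> x y; rewrite inE => /andP[nCx Ax] Cy.
move: (Cy); rewrite inE => /and3P[Ay ya nyb].
(* If [y] shared a lower bound with [b], it would clash with [b] and thus be [a], though it is
   strictly below [a]. *)
have sep u : ple lt u y -> ple lt u b -> False.
  move=> uy ub; have : clash lt predT b y.
    apply/clashP; split=> //; last by exists u.
    by apply: contra nba => /ple_lt_trans/(_ ya)/ltW.
  move/(matched _ _ _ (clash_sym ab)) => E; by rewrite E lt_irr in ya.
split.
  apply/negP => xy; case/negP: nCx; rewrite inE Ax (lt_tr xy ya) /=.
  by apply/negP => /(sep x (ltW xy)).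
(* By maximality of [a], being above [a] in [A] means being equal to [a]. *)
rewrite /ple amax // orbF; apply/idP/eqP => [yx|<- //].
apply/eqP/negPn/negP => nax.
case/orP: (cov x Ax) => [/orP[/eqP xa|xa]|xb].
- by rewrite xa eqxx in nax.
- case/negP: nCx; rewrite inE Ax xa /=; apply/negP => xb.
  by case/negP: nyb; apply: ltW; apply: lt_ple_trans xb.
- by case/negP: nyb; apply: ltW; apply: lt_ple_trans xb.
Qed.

Lemma forest_dup_on_component (A D : {set T}) :
  D \subset A -> D != set0 -> D != A ->
  {in D & A :\: D, forall x y, lt x y = false /\ lt y x = false} ->
  (forall B : {set T}, B \proper A -> B != set0 -> forest_dup_on B) ->
  forest_dup_on A.
Proof.
move=> sDA D0 DA nc IH.
have EA : D :|: A :\: D = A by rewrite -{1}(setIidPr sDA) setID.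
have AD0 : A :\: D != set0.
  by rewrite setD_eq0; apply: contra DA => sAD; rewrite eqEsubset sDA.
rewrite -EA; apply: forest_dup_onU nc.
- by apply: IH; rewrite // properEneq DA.
- apply: IH => //; case/set0Pn: D0 => d Dd; apply/properP.
  split; first exact: subsetDl.
  by exists d; [apply: (subsetP sDA)|rewrite inE Dd].
- by rewrite -setI_eq0 setIDA setDIl setDv set0I.
Qed.

Lemma well_matched_forest_dup_on (A : {set T}) :
  well_matched lt -> A != set0 -> forest_dup_on A.
Proof.
move=> wm; have [matched upper] := wm.
have [k] := ubnP #|A|; elim: k A => // k IHk A ltk A0.
have {IHk ltk}IH (B : {set T}) : B \proper A -> B != set0 -> forest_dup_on B.
  by move=> /proper_card pB; apply: IHk; apply: leq_trans pB _.
have [a Aa amax] := exists_maximal A0.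
(* A comparability leaving the ideal of [a] upwards ends in an element clashing with [a], with a
   witness inside [A]. *)
have out x y : x \in A -> y \in A -> ple lt x a -> ~~ ple lt y a ->
    lt x y -> clash lt (mem A) a y.
  move=> Ax Ay xa nya xy; apply/clashP; split=> //; last first.
    by exists x => //; split=> //; apply: ltW.
  rewrite /ple amax // orbF; apply/eqP => E; by rewrite E ple_refl in nya.
case: (boolP [exists b in A, clash lt (mem A) a b]) => [/exists_inP[b Ab abA]|].
  have ab := clash_mono abA; have /clashP[nab nba [z Az [za zb]]] := abA.
  have bmax x : x \in A -> lt b x = false.
    by move=> Ax; apply/negP => /(upper _ _ _ ab); rewrite amax.
  pose D := [set x in A | ple lt x a || ple lt x b].
  have sDA : D \subset A by apply/subsetP => x; rewrite inE => /andP[].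
  have Da : a \in D by rewrite inE Aa ple_refl.
  case: (eqVneq D A) => [DA|DA]; last first.
    (* An element outside [D] above one of [D] would clash with [a] or [b], giving one of them a
       second partner. *)
    apply: (forest_dup_on_component sDA) => //; first by apply/set0Pn; exists a.
    move=> x y; rewrite !inE => /andP[Ax xab].
    case/andP => + Ay; rewrite Ay /= => /norP[nya nyb]; split; last first.
      apply/negP => yx; case/orP: xab => [xa|xb].
        by case/negP: nya; apply: ltW; apply: lt_ple_trans xa.
      by case/negP: nyb; apply: ltW; apply: lt_ple_trans xb.
    apply/negP => xy; case/orP: xab => [xa|xb].
      have /clash_mono/(matched _ _ _ ab) E := out x y Ax Ay xa nya xy.
      by rewrite -E ple_refl in nyb.
    have : clash lt predT b y.
      apply/clashP; split=> //; last by exists x => //; split=> //; apply: ltW.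
      rewrite /ple bmax // orbF; apply/eqP => E; by rewrite E ple_refl in nyb.
    by move/(matched _ _ _ (clash_sym ab)) => E; rewrite -E ple_refl in nya.
  have cov x : x \in A -> ple lt x a || ple lt x b.
    by rewrite -{1}DA inE => /andP[].
  (* Whatever lies under only one of [a], [b] is unhung first; afterwards both have the same strict
     lower bounds in [A]. *)
  case: (eqVneq [set x in A | lt x a && ~~ ple lt x b] set0) => [Ca|Ca]; last first.
    exact: forest_dup_on_unhang wm ab Aa Ab amax cov Ca IH.
  case: (eqVneq [set x in A | lt x b && ~~ ple lt x a] set0) => [Cb|Cb]; last first.
    apply: forest_dup_on_unhang wm (clash_sym ab) Ab Aa bmax _ Cb IH.
    by move=> x Ax; rewrite orbC cov.
  have nbeq x : x \in A -> x != b -> ple lt x a.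
    move=> Ax xb; case/orP: (cov x Ax) => //; rewrite /ple (negbTE xb) /= => ltxb.
    have := in_set0 x; rewrite -Cb inE Ax ltxb /= => /negbFE.
    by rewrite /ple.
  have lows x : x \in A -> lt x b = lt x a.
    move=> Ax; apply/idP/idP => h.
      have := in_set0 x; rewrite -Cb inE Ax h /= => /negbFE/orP[/eqP xa|//].
      by case/negP: nab; rewrite -xa ltW.
    have := in_set0 x; rewrite -Ca inE Ax h /= => /negbFE/orP[/eqP xb|//].
    by case/negP: nba; rewrite -xb ltW.
  have nab' : a != b by apply: contraNneq nab => ->; apply: ple_refl.
  have zlta : lt z a.
    by case/orP: za zb => // /eqP -> ; rewrite (negbTE nab).
  have zb' : z != b by apply: contraNneq nba => <-.
  (* Without [b], the element [a] is the top of the rest. The common lower bound [z] is strictly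
     below [a], so [b] is the copy made by duplicating [a]. *)
  rewrite -(setD1K Ab); apply: (@forest_dup_on_dup _ a b z) => //.
  - apply: IH; last by apply/set0Pn; exists a; rewrite !inE nab'.
    by rewrite properD1.
  - by rewrite !inE nab'.
  - by rewrite !inE eqxx.
  - by rewrite !inE zb'.
  - by move=> x; rewrite !inE => /andP[xb Ax]; apply: nbeq.
  - by move=> x; rewrite !inE => /andP[xb Ax]; rewrite lows // amax // bmax.
move/exists_inPn => noc.
pose D := [set x in A | ple lt x a].
have sDA : D \subset A by apply/subsetP => x; rewrite inE => /andP[].
have Da : a \in D by rewrite inE Aa ple_refl.
case: (eqVneq D A) => [DA|DA]; last first.
  apply: (forest_dup_on_component sDA) => //; first by apply/set0Pn; exists a.
  move=> x y; rewrite !inE => /andP[Ax xa].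
  case/andP => + Ay; rewrite Ay /= => nya; split; apply/negP.
    by move/(out x y Ax Ay xa nya); apply/negP/noc.
  by move=> yx; case/negP: nya; apply: ltW; apply: lt_ple_trans xa.
have cov x : x \in A -> ple lt x a by rewrite -{1}DA inE => /andP[].
rewrite -(setD1K Aa).
(* Now [a] is the top of [A]: the rest, if any, hangs below the one-point poset [a]. *)
case: (eqVneq (A :\ a) set0) => [->|A'0].
  by rewrite setU0; apply: forest_dup_on1.
apply: (@forest_dup_on_hang _ _ a); rewrite ?inE ?eqxx //.
- exact: forest_dup_on1.
- by apply: IH; rewrite // properD1.
- by rewrite disjoints1 !inE eqxx.
- move=> x y; rewrite !inE => /eqP -> /andP[nya Ay]; rewrite amax // ple_refl.
  by split=> //; have := cov y Ay; rewrite /ple (negbTE nya).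
Qed.

End Posets.

Lemma forest_dup_on_setT n (lt : rel 'I_n) :
  forest_dup_on lt setT -> forest_dup lt.
Proof.
case=> m [r [f [d inj E h]]].
have emn : m = n.
  by have := card_imset setT inj; rewrite E !cardsT !card_ord.
(* Between ordinals of equal size the embedding is a permutation, and its inverse does the
   relabelling. *)
subst m; have -> : lt = (fun x y => r ((perm inj)^-1%g x) ((perm inj)^-1%g y)).
  apply: functional_extensionality => x; apply: functional_extensionality => y.
  by rewrite h -!(permE inj) !permKV.
exact: FD_relabel.
Qed.

(** * Forests with duplications are well matched *)

Lemma relabel_well_matched n (r : rel 'I_n) (s : {perm 'I_n}) :
  is_strict_poset r /\ well_matched r ->
  is_strict_poset (fun x y => r (s x) (s y)) /\
  well_matched (fun x y => r (s x) (s y)).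
Proof.
move=> [[irr tr] [matched upper]]; split.
  by split=> [x|x y z]; [apply: irr|apply: tr].
have pleE x y : ple (fun x y => r (s x) (s y)) x y = ple r (s x) (s y).
  by rewrite /ple (inj_eq perm_inj).
have cl a b : clash (fun x y => r (s x) (s y)) predT a b -> clash r predT (s a) (s b).
  case/clashP; rewrite !pleE => ab ba [z _]; rewrite !pleE => zab.
  by apply/clashP; split=> //; exists (s z).
split=> [a b c /cl ab /cl ac|a b c /cl ab bc]; last exact: upper bc.
by apply/(@perm_inj _ s)/(matched (s a)).
Qed.

Section Constructions.
Variables (n1 n2 : nat) (r1 : rel 'I_n1) (r2 : rel 'I_n2).
Hypotheses (p1 : is_strict_poset r1) (p2 : is_strict_poset r2).
Hypotheses (w1 : well_matched r1) (w2 : well_matched r2).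

Lemma split_elim (P : 'I_(n1 + n2) -> Prop) :
  (forall i, P (unsplit (inl i))) -> (forall j, P (unsplit (inr j))) -> forall x, P x.
Proof. by move=> Pl Pr x; rewrite -(splitK x); case: (split x). Qed.

Lemma unsplit_inj : injective (@unsplit n1 n2).
Proof. exact: can_inj (@unsplitK n1 n2). Qed.

(** Elements of different summands have no common lower bound, so every clash lives inside one
    summand. *)
Lemma dunion_well_matched :
  is_strict_poset (dunion_rel r1 r2) /\ well_matched (dunion_rel r1 r2).
Proof.
have [irr1 tr1] := p1; have [irr2 tr2] := p2.
have [m1 u1] := w1; have [m2 u2] := w2; set r := dunion_rel r1 r2.
have rll i j : r (unsplit (inl i)) (unsplit (inl j)) = r1 i j.
  by rewrite /r /dunion_rel !unsplitK.
have rrr i j : r (unsplit (inr i)) (unsplit (inr j)) = r2 i j.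
  by rewrite /r /dunion_rel !unsplitK.
have rlr i j : r (unsplit (inl i)) (unsplit (inr j)) = false.
  by rewrite /r /dunion_rel !unsplitK.
have rrl i j : r (unsplit (inr i)) (unsplit (inl j)) = false.
  by rewrite /r /dunion_rel !unsplitK.
have rE := (rll, rrr, rlr, rrl).
have pE : (forall i j, ple r (unsplit (inl i)) (unsplit (inl j)) = ple r1 i j) *
          (forall i j, ple r (unsplit (inr i)) (unsplit (inr j)) = ple r2 i j) *
          (forall i j, ple r (unsplit (inl i)) (unsplit (inr j)) = false) *
          (forall i j, ple r (unsplit (inr i)) (unsplit (inl j)) = false).
  by do ![split] => i j; rewrite /ple (inj_eq unsplit_inj) rE.
split.
  split; first by elim/split_elim => i; rewrite rE.
  elim/split_elim => i; elim/split_elim => j; elim/split_elim => k; rewrite !rE //.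
    exact: tr1.
  exact: tr2.
have [cll crr clr crl] :
    [/\ forall i j, clash r predT (unsplit (inl i)) (unsplit (inl j)) ->
          clash r1 predT i j,
        forall i j, clash r predT (unsplit (inr i)) (unsplit (inr j)) ->
          clash r2 predT i j,
        forall i j, ~ clash r predT (unsplit (inl i)) (unsplit (inr j))
      & forall i j, ~ clash r predT (unsplit (inr i)) (unsplit (inl j))].
  split=> i j /clashP[+ + [z _]]; elim/split_elim: z => z; rewrite !pE;
    try by move=> _ _ [].
  - by move=> *; apply/clashP; split=> //; exists z.
  - by move=> *; apply/clashP; split=> //; exists z.
split.
  elim/split_elim => i; elim/split_elim => j; elim/split_elim => k;
    try solve [move=> /clr // | move=> /crl // | move=> _ /clr // | move=> _ /crl //].
  - by move=> /cll ij /cll ik; rewrite (m1 i j k).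
  - by move=> /crr ij /crr ik; rewrite (m2 i j k).
elim/split_elim => i; elim/split_elim => j; elim/split_elim => k;
  try solve [move=> /clr // | move=> /crl //]; rewrite !rE //.
- by move=> /cll; apply: u1.
- by move=> /crr; apply: u2.
Qed.

(** No clash crosses the two parts: a common lower bound would lie in the hung part, putting the
    upper element above [a] and hence above everything hung. *)
Lemma hang_well_matched a :
  is_strict_poset (hang_rel r1 r2 a) /\ well_matched (hang_rel r1 r2 a).
Proof.
have [irr1 tr1] := p1; have [irr2 tr2] := p2.
have [m1 u1] := w1; have [m2 u2] := w2; set r := hang_rel r1 r2 a.
have rll i j : r (unsplit (inl i)) (unsplit (inl j)) = r1 i j.
  by rewrite /r /hang_rel !unsplitK.
have rrr i j : r (unsplit (inr i)) (unsplit (inr j)) = r2 i j.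
  by rewrite /r /hang_rel !unsplitK.
have rlr i j : r (unsplit (inl i)) (unsplit (inr j)) = false.
  by rewrite /r /hang_rel !unsplitK.
have rrl i j : r (unsplit (inr i)) (unsplit (inl j)) = ple r1 a j.
  by rewrite /r /hang_rel !unsplitK.
have rE := (rll, rrr, rlr, rrl).
have pE : (forall i j, ple r (unsplit (inl i)) (unsplit (inl j)) = ple r1 i j) *
          (forall i j, ple r (unsplit (inr i)) (unsplit (inr j)) = ple r2 i j) *
          (forall i j, ple r (unsplit (inl i)) (unsplit (inr j)) = false) *
          (forall i j, ple r (unsplit (inr i)) (unsplit (inl j)) = ple r1 a j).
  by do ![split] => i j; rewrite /ple (inj_eq unsplit_inj) rE.
split.
  split; first by elim/split_elim => i; rewrite rE.
  elim/split_elim => i; elim/split_elim => j; elim/split_elim => k; rewrite !rE //.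
  - exact: tr1.
  - by move=> aj /(ple_lt_trans p1 aj)/ltW.
  - exact: tr2.
have [cll crr clr crl] :
    [/\ forall i j, clash r predT (unsplit (inl i)) (unsplit (inl j)) ->
          clash r1 predT i j,
        forall i j, clash r predT (unsplit (inr i)) (unsplit (inr j)) ->
          clash r2 predT i j,
        forall i j, ~ clash r predT (unsplit (inl i)) (unsplit (inr j))
      & forall i j, ~ clash r predT (unsplit (inr i)) (unsplit (inl j))].
  split=> i j /clashP[+ + [z _]]; elim/split_elim: z => z; rewrite !pE;
    try by move=> _ _ [].
  - by move=> *; apply/clashP; split=> //; exists z.
  (* Two elements above a hung [z] are both above [a], which replaces [z] as the common lower
     bound. *)
  - by move=> *; apply/clashP; split=> //; exists a.
  - by move=> *; apply/clashP; split=> //; exists z.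
  - by move=> _ /negP nai [].
  - by move=> /negP nai _ [].
split.
  elim/split_elim => i; elim/split_elim => j; elim/split_elim => k;
    try solve [move=> /clr // | move=> /crl // | move=> _ /clr // | move=> _ /crl //].
  - by move=> /cll ij /cll ik; rewrite (m1 i j k).
  - by move=> /crr ij /crr ik; rewrite (m2 i j k).
elim/split_elim => i; elim/split_elim => j; elim/split_elim => k;
  try solve [move=> /clr // | move=> /crl //]; rewrite !rE //.
- by move=> /cll; apply: u1.
- by move=> /crr; apply: u2.
Qed.

End Constructions.

(* An upward Hasse path from a common lower bound to [x] stays below [x],
   hence avoids [a]. *)
Lemma hanger_no_clash (T : finType) (lt : rel T) a x :
  is_strict_poset lt -> hanger lt a -> ~ clash lt predT a x.
Proof.
move=> po [_ sep] /clashP[nax nxa [z _ [za zx]]].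
have za' : lt z a.
  by case/orP: za zx => // /eqP ->; rewrite (negbTE nax).
apply: (sep z x za' nxa).
have zx' : lt z x by case/orP: zx za => // /eqP ->; rewrite (negbTE nxa).
apply: (lt_connect po (A := predT)) zx' => // u v vx /[dup] cuv /and4P[_ _ uv _].
rewrite /hasse_adj cuv /=; apply/andP; split; apply: contraNneq nax => <- //.
by apply: ltW; apply: lt_ple_trans vx.
Qed.

(** A hanger clashes with nothing, so [a] and its copy can clash only with each other, and they
    share their strict upper bounds. All other clashes come from [r]. *)
Lemma dup_well_matched n (r : rel 'I_n) a :
  hanger r a -> is_strict_poset r /\ well_matched r ->
  is_strict_poset (dup_rel r a) /\ well_matched (dup_rel r a).
Proof.
move=> hg [po [m u]]; have [irr tr] := po; set r' := dup_rel r a.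
have noc x : ~ clash r predT a x by apply: hanger_no_clash.
have noc' x : ~ clash r predT x a by move/(clash_sym); apply: noc.
have up_elim (P : 'I_n.+1 -> Prop) :
    (forall i, P (lift ord_max i)) -> P ord_max -> forall x, P x.
  by move=> Pl Pr x; case: (unliftP ord_max x) => [i ->|->].
have r11 i j : r' (lift ord_max i) (lift ord_max j) = r i j.
  by rewrite /r' /dup_rel !liftK.
have r10 i : r' (lift ord_max i) ord_max = r i a.
  by rewrite /r' /dup_rel !liftK unlift_none.
have r01 i : r' ord_max (lift ord_max i) = r a i.
  by rewrite /r' /dup_rel !liftK unlift_none.
have r00 : r' ord_max ord_max = false by rewrite /r' /dup_rel unlift_none.
have rE := (r11, r10, r01, r00).
have pE : (forall i j, ple r' (lift ord_max i) (lift ord_max j) = ple r i j) *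
          (forall i, ple r' (lift ord_max i) ord_max = r i a) *
          (forall i, ple r' ord_max (lift ord_max i) = r a i) *
          (ple r' ord_max ord_max = true).
  do ![split].
  - by move=> i j; rewrite /ple (inj_eq (@lift_inj _ _)) rE.
  - by move=> i; rewrite /ple eq_sym (negbTE (neq_lift _ _)) rE.
  - by move=> i; rewrite /ple (negbTE (neq_lift _ _)) rE.
  - by rewrite /ple eqxx.
split.
  split; first by elim/up_elim => [i|]; rewrite rE.
  elim/up_elim => [i|]; elim/up_elim => [j|]; elim/up_elim => [k|]; rewrite !rE //;
    try exact: tr.
  by move=> aj /(tr _ _ _ aj); rewrite (negbTE (irr a)).
have c11 i j : clash r' predT (lift ord_max i) (lift ord_max j) -> clash r predT i j.
  case/clashP; rewrite !pE => ij ji [z _]; elim/up_elim: z => [z|]; rewrite !pE.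
    by move=> ?; apply/clashP; split=> //; exists z.
  (* When the common lower bound is the copy, [a] serves in its place. *)
  by case=> /ltW ai /ltW aj; apply/clashP; split=> //; exists a.
have c10 i : clash r' predT (lift ord_max i) ord_max -> i = a.
  case/clashP; rewrite !pE => nia nai [z _]; elim/up_elim: z => [z|]; rewrite !pE.
    (* An element other than [a] clashing with the copy would already clash with [a] in [r]. *)
    case=> zi za; apply/eqP/negPn/negP => ia; apply: (@noc i); apply/clashP.
    split; last by exists z => //; split=> //; apply: ltW.
      by rewrite /ple eq_sym (negbTE ia).
    by rewrite /ple (negbTE ia).
  by case; rewrite (negbTE nai).
have c01 i : clash r' predT ord_max (lift ord_max i) -> i = a.
  by move/clash_sym/c10.
have c00 : ~ clash r' predT ord_max ord_max by case/clashP; rewrite pE.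
split.
  elim/up_elim => [i|]; elim/up_elim => [j|]; elim/up_elim => [k|] //.
  - by move=> /c11 ij /c11 ik; rewrite (m i j k).
  - by move=> /c11 + /c10 E; rewrite E => /noc.
  - by move=> /c10 E /c11; rewrite E => /noc.
  - by move=> /c01 -> /c01 ->.
elim/up_elim => [i|]; elim/up_elim => [j|]; elim/up_elim => [k|] //; rewrite !rE //.
- by move=> /c11; apply: u.
- by move=> /c11; apply: u.
- by move=> /c10 ->.
- by move=> /c01 ->.
- by move=> /c01 ->; rewrite (negbTE (irr a)).
Qed.

Lemma forest_dup_well_matched n (r : rel 'I_n) :
  forest_dup r -> is_strict_poset r /\ well_matched r.
Proof.
elim=> {n r} [|n r s _|n1 n2 r1 r2 _ [p1 w1] _ [p2 w2]
             |n1 n2 r1 r2 a _ [p1 w1] _ [p2 w2]|n r a _ IH hg].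
- by do ![split] => // a b; rewrite !ord1 => c /clashP[]; rewrite /ple eqxx.
- exact: relabel_well_matched.
- exact: dunion_well_matched.
- exact: hang_well_matched.
- exact: dup_well_matched.
Qed.

(** * Equivalence of the construction and the count *)

Theorem theorem1p3 (n : nat) (lt : rel 'I_n) :
  0 < n -> is_strict_poset lt ->
  (forest_dup lt <-> #|Jconn lt| = n + #|PiP lt|).
Proof.
move=> n_gt0 po; rewrite -[X in X + _]card_ord; split=> [d|].
  apply/(card_Jconn_eq_inj po)/well_matched_cover_inj => //.
  by case: (forest_dup_well_matched d).
move=> /(card_Jconn_eq_inj po)/(cover_inj_well_matched po) wm.
apply/forest_dup_on_setT/well_matched_forest_dup_on => //.
(* The empty poset satisfies the count but no constructor yields it, so positivity of [n] enters
   here. *)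
by apply/set0Pn; exists (Ordinal n_gt0).
Qed.
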